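(* Let $n\geqslant 2$ be an integer. Define the operator $\Omega:\mathcal{L}\rightarrow\mathcal{L}$ by $$\Omega F(x)=nx^{n-1}-(n-1)x^n-2n(n-1)\int_{(2x-1)^+}^{x}y^{n-2}\int_0^{\frac{1}{2}+\frac{y}{2}-x}F(z)\,dz\,dy,\qquad 0\leqslant x\leqslant 1,\quad F\in\mathcal{L}.$$ Then $\Omega$ is a contraction mapping on $\mathcal{L}$ with contraction constant $\left(\frac{n-1}{n}\right)^{n-1}$; that is, $\left(\frac{n-1}{n}\right)^{n-1}<1$ and $\|\Omega F_1-\Omega F_2\|\leqslant \left(\frac{n-1}{n}\right)^{n-1}\|F_1-F_2\|$ for all $F_1,F_2\in\mathcal{L}$.
   Context: $\mathcal{L}=\mathcal{L}^\infty([0,1])$ denotes the space of all measurable and bounded (real-valued) functions on $[0,1]$, endowed with the sup norm $\|F\|=\sup_{x\in[0,1]}|F(x)|$. Notation: $u^+=\max\{0,u\}$. *)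

(* Defs.v *)
From HB Require Import structures.
From mathcomp Require Import all_boot all_order all_algebra.
From mathcomp Require Import all_classical all_reals all_analysis.

Set Implicit Arguments.
Unset Strict Implicit.
Unset Printing Implicit Defensive.

Import Order.TTheory GRing.Theory Num.Theory.
Import numFieldNormedType.Exports.

Local Open Scope classical_set_scope.
Local Open Scope ring_scope.

(* A function on [0, 1] is represented by a function on R whose values outside
   [0, 1] are irrelevant: none of the definitions below, restricted to points of
   [0, 1], depends on them.  Measurability is with respect to Borel sets. *)
Definition Linfty01 (R : realType) (F : R -> R) : Prop :=
  measurable_fun (`[0, 1] : set R) F /\ [bounded F x | x in (`[0, 1] : set R)].

Definition supnorm01 (R : realType) (F : R -> R) : R :=
  sup [set `|F x| | x in (`[0, 1] : set R)].

(* For 0 <= x <= 1 both integrals have ordered bounds, and the inner one ranges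
   over a subinterval of [0, 1 / 2]. *)
Definition Omega (R : realType) (n : nat) (F : R -> R) (x : R) : R :=
  n%:R * x ^+ (n - 1)%N - (n - 1)%N%:R * x ^+ n
  - 2 * n%:R * (n - 1)%N%:R *
    \int[lebesgue_measure]_(y in `[Num.max 0 (2 * x - 1), x])
      (y ^+ (n - 2)%N *
       \int[lebesgue_measure]_(z in `[0, 2^-1 + y / 2 - x]) F z).

(* Main.v *)
(* With D = ||F1 - F2||, the inner integral of F1 - F2 is at
   most D (1 - x) / 2 because y <= x, so that
   |Omega F1 x - Omega F2 x| <= n (n - 1) D (1 - x) \int_0^x y^(n-2) dy
                              = D n x^(n-1) (1 - x),
   and x^(n-1) (1 - x) is maximal at x = (n - 1) / n.  Measurability and
   boundedness of Omega F hold because the double integral is Lipschitz in x. *)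
Require Import Defs.
From HB Require Import structures.
From mathcomp Require Import all_boot all_order all_algebra.
From mathcomp Require Import all_classical all_reals all_analysis.
From mathcomp Require Import measurable_realfun ring lra.

Import Order.TTheory GRing.Theory Num.Theory.
Import numFieldNormedType.Exports.

Local Open Scope classical_set_scope.
Local Open Scope ring_scope.

(** * Lipschitz continuity and an elementary polynomial inequality *)

Lemma lipschitz_within_continuous (R : realType) (A : set R) (f : R -> R) (L : R) :
  (forall s t, A s -> A t -> s <= t -> `|f t - f s| <= L * (t - s)) ->
  {within A, continuous f}.
Proof.
move=> fL; apply/subspace_continuousP => s As; apply/cvgrPdist_le => e e0.
(* [L] may be zero or negative, so the radius is e / ([|L| + 1]) instead of e / L. *)
have L0 : 0 < `|L| + 1 by rewrite ltr_wpDl.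
have LL : L <= `|L| + 1 by rewrite (le_trans (ler_norm _))// lerDl.
have : \forall t \near within A (nbhs s), A t /\ `|s - t| <= e / (`|L| + 1).
  near=> t; split; first by near: t; exact: withinT.
  near: t; apply: cvg_within.
  by move/cvgrPdist_le : (@cvg_id _ (nbhs s)); apply; rewrite divr_gt0.
apply: filterS => t [At]; rewrite ler_pdivlMr// => /(le_trans _); apply.
rewrite mulrC; have [st|/ltW ts] := leP s t.
  rewrite distrC (distrC s) (ger0_norm (_ : 0 <= t - s)) ?subr_ge0//.
  by apply: le_trans (fL _ _ As At st) _; rewrite ler_wpM2r// subr_ge0.
rewrite (ger0_norm (_ : 0 <= s - t)) ?subr_ge0//.
by apply: le_trans (fL _ _ At As ts) _; rewrite ler_wpM2r// subr_ge0.
Unshelve. all: by end_near. Qed.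

(** Weighted AM-GM for m copies of x^(m+1) and one of c^(m+1), with equality at x = c. Here it is
    proved by induction, which keeps it free of roots and derivatives. *)
Lemma exprn_interpolation (R : realDomainType) (m : nat) (c x : R) :
  0 <= x -> 0 <= c -> m.+1%:R * x ^+ m * c <= m%:R * x ^+ m.+1 + c ^+ m.+1.
Proof.
move=> x0 c0; elim: m => [|m IH]; first by rewrite !expr0 !mulr1 mul0r add0r mul1r.
(* Adding this nonnegative term to c times the induction hypothesis gives the next case. *)
have : 0 <= (m.+1%:R * x ^+ m) * (x - c) ^+ 2.
  by apply: mulr_ge0 (sqr_ge0 _); rewrite mulr_ge0// exprn_ge0.
move: IH => /(ler_wpM2l c0); rewrite -!natr1 !exprS expr0; lra.
Qed.

(** * Integrals over closed intervals *)

Section interval_Rintegral.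
Context {R : realType}.
Local Notation mu := (@lebesgue_measure R).
Implicit Types (a b M : R) (f g : R -> R).

Lemma integrable_cst_itvcc a b M : mu.-integrable `[a, b] (EFin \o cst M).
Proof.
apply: continuous_compact_integrable; first exact: segment_compact.
by apply: continuous_subspaceT => x; exact: cst_continuous.
Qed.

Lemma integrable_itvcc_bounded a b f M : measurable_fun `[a, b] f ->
  (forall y, a <= y <= b -> `|f y| <= M) -> mu.-integrable `[a, b] (EFin \o f).
Proof.
move=> mf fM; apply: (le_integrable _ _ _ (integrable_cst_itvcc a b M)) => //.
  exact/measurable_EFinP.
move=> y /=; rewrite in_itv/= => yab; rewrite lee_fin.
exact: le_trans (fM _ yab) (ler_norm _).
Qed.

Lemma normr_Rintegral_le (D : set R) f g : measurable D -> measurable_fun D f ->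
  mu.-integrable D (EFin \o g) -> (forall y, D y -> `|f y| <= g y) ->
  `|\int[mu]_(y in D) f y| <= \int[mu]_(y in D) g y.
Proof.
move=> mD mf ig fg.
have If : mu.-integrable D (EFin \o f).
  apply: (le_integrable _ _ _ ig) => //; first exact/measurable_EFinP.
  by move=> y Dy /=; rewrite lee_fin (le_trans (fg _ Dy))// ler_norm.
apply: le_trans (le_normr_Rintegral _ _) _ => //.
by apply: le_Rintegral => //; exact: integrable_norm.
Qed.

Lemma Rintegral_cst_itvcc a b M : a <= b -> \int[mu]_(_ in `[a, b]) M = M * (b - a).
Proof.
move=> ab; have <- : fine (mu `[a, b]) = b - a; last exact: Rintegral_cst.
rewrite lebesgue_measure_itv/= lte_fin.
by case: ltgtP ab => // ->; rewrite subrr.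
Qed.

Lemma normr_Rintegral_itvcc_le a b f M : a <= b -> measurable_fun `[a, b] f ->
  (forall y, a <= y <= b -> `|f y| <= M) ->
  `|\int[mu]_(y in `[a, b]) f y| <= M * (b - a).
Proof.
move=> ab mf fM; rewrite -Rintegral_cst_itvcc//.
by apply: normr_Rintegral_le => //; exact: integrable_cst_itvcc.
Qed.

(** No order between [a] and [s], [t] is imposed: to the left of [a] the interval is empty and the
    integral is 0. This matters because the inner upper limit 1/2 + y/2 - x can be negative once y
    runs over all of [0, x]. *)
Lemma Rintegral_itvcc_lipschitz a b f M s t : 0 <= M ->
  measurable_fun `[a, b] f -> (forall y, a <= y <= b -> `|f y| <= M) ->
  s <= t -> t <= b ->
  `|\int[mu]_(y in `[a, t]) f y - \int[mu]_(y in `[a, s]) f y| <= M * (t - s).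
Proof.
move=> M0 mf fM st tb.
have mft c d : a <= c -> d <= b -> measurable_fun `[c, d] f.
  move=> ac db; apply: measurable_funS mf => //.
  exact: subset_itvScc.
have [ta|at_] := ltP t a.
  rewrite !set_itv_ge ?bnd_simp -?ltNge// ?(le_lt_trans st)//.
  by rewrite !Rintegral_set0 subrr normr0 mulr_ge0// subr_ge0.
(* If s < a <= t, only the integral up to [t] survives, and t - a <= t - s. *)
have [sa|as_] := ltP s a.
  rewrite (@set_itv_ge _ _ _ (BRight s)) ?bnd_simp -?ltNge// Rintegral_set0 subr0.
  rewrite (le_trans (@normr_Rintegral_itvcc_le _ _ _ M _ _ _))//.
  - exact: mft.
  - by move=> y /andP[ay yt]; rewrite fM// ay (le_trans yt).
  - by rewrite ler_wpM2l// lerB// ltW.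
rewrite Rintegral_itvB ?bnd_simp//; last first.
  apply: (@integrable_itvcc_bounded _ _ _ M); first exact: mft.
  by move=> y /andP[ay yt]; rewrite fM// ay (le_trans yt).
have fMst y : s <= y <= t -> `|f y| <= M.
  by move=> /andP[sy yt]; rewrite fM// (le_trans as_)//= (le_trans yt).
rewrite Rintegral_itv_obnd_cbnd.
  by rewrite normr_Rintegral_itvcc_le//; exact: mft.
apply: integrableS (integrable_itvcc_bounded _ _ _ M (mft s t as_ tb) fMst) => //.
by apply: subset_itvScc; rewrite bnd_simp.
Qed.

Lemma Rintegral_exprn (m : nat) (x : R) : 0 <= x ->
  \int[mu]_(y in `[0, x]) y ^+ m = x ^+ m.+1 / m.+1%:R.
Proof.
rewrite le_eqVlt => /predU1P[<-|x0].
  by rewrite set_itv1 Rintegral_set1 expr0n mul0r.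
have dF (y : R) : derivable (fun z : R => z ^+ m.+1 / m.+1%:R) y 1.
  by apply: derivableM => //; exact: exprn_derivable.
rewrite /Rintegral (continuous_FTC2 (F := fun y => y ^+ m.+1 / m.+1%:R))//=.
- by rewrite expr0n mul0r subr0.
- by apply: continuous_subspaceT => y; exact: exprn_continuous.
- have cF : continuous (fun z : R => z ^+ m.+1 / m.+1%:R).
    by move=> y; apply/differentiable_continuous/derivable1_diffP.
  split => [y _//| |].
  + exact/cvg_at_right_filter/cF.
  + exact/cvg_at_left_filter/cF.
- move=> y _; rewrite derive1Mr//; last exact: exprn_derivable.
  by rewrite exp_derive1 /= mulrAC divff// mul1r.
Qed.

End interval_Rintegral.

(** * The double integral in [Omega], with [m] standing for n - 2 *)

Section Omega_integrals.
Context {R : realType} (m : nat).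
Local Notation mu := (@lebesgue_measure R).
Local Notation prim F := (fun t : R => \int[mu]_(z in `[0, t]) F z).
Local Notation K F := (fun x : R => \int[mu]_(y in `[Num.max 0 (2 * x - 1), x])
  (y ^+ m * prim F (2^-1 + y / 2 - x))).
Implicit Types (x y t M : R) (F : R -> R).

Lemma primitive_lt0 F t : t < 0 -> prim F t = 0.
Proof. by move=> t0 /=; rewrite set_itv_ge ?bnd_simp -?ltNge// Rintegral_set0. Qed.

Lemma primitive_le F M t : measurable_fun (`[0, 1] : set R) F ->
  (forall z, 0 <= z <= 1 -> `|F z| <= M) -> 0 <= t <= 1 -> `|prim F t| <= M * t.
Proof.
move=> mF FM /andP[t0 t1]; rewrite -[t in _ <= M * t]subr0.
apply: normr_Rintegral_itvcc_le => //.
  by apply: measurable_funS mF => //; apply: subset_itvScc; rewrite bnd_simp.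
by move=> y /andP[y0 yt]; rewrite FM// y0 (le_trans yt).
Qed.

Lemma primitive_bounded F M t : 0 <= M -> measurable_fun (`[0, 1] : set R) F ->
  (forall z, 0 <= z <= 1 -> `|F z| <= M) -> t <= 1 -> `|prim F t| <= M.
Proof.
move=> M0 mF FM t1; have [t0|t0] := ltP t 0.
  by rewrite primitive_lt0// normr0.
by rewrite (le_trans (primitive_le _ _ _ mF FM _)) ?t0// ler_piMr.
Qed.

(** The primitive is Lipschitz, hence continuous. The domain reaches down to -oo so that it contains
    every value of 1/2 + y/2 - x for x >= 0 and y in [0, 1]. *)
Lemma measurable_primitive F M : 0 <= M -> measurable_fun (`[0, 1] : set R) F ->
  (forall z, 0 <= z <= 1 -> `|F z| <= M) -> measurable_fun (`]-oo, 1] : set R) (prim F).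
Proof.
move=> M0 mF FM; apply: subspace_continuous_measurable_fun => //.
apply: (@lipschitz_within_continuous _ _ _ M) => s t _ /=.
by rewrite in_itv/= => t1 st; exact: (Rintegral_itvcc_lipschitz 0 1).
Qed.

Lemma measurable_integrand F M x : 0 <= M -> measurable_fun (`[0, 1] : set R) F ->
  (forall z, 0 <= z <= 1 -> `|F z| <= M) -> 0 <= x ->
  measurable_fun (`[0, 1] : set R) (fun y => y ^+ m * prim F (2^-1 + y / 2 - x)).
Proof.
move=> M0 mF FM x0; apply: measurable_funM; first exact: measurable_funX.
apply: (measurable_comp _ _ (measurable_primitive _ _ M0 mF FM)) => //.
  by move=> _ [y /= + <-]; rewrite !in_itv/= => /andP[y0 y1]; lra.
by apply: measurable_funB => //; apply: measurable_funD => //; exact: measurable_funM.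
Qed.

Lemma integrand_bounded F M x : 0 <= M -> measurable_fun (`[0, 1] : set R) F ->
  (forall z, 0 <= z <= 1 -> `|F z| <= M) -> 0 <= x -> forall y, 0 <= y <= 1 ->
  `|y ^+ m * prim F (2^-1 + y / 2 - x)| <= M.
Proof.
move=> M0 mF FM x0 y /andP[y0 y1]; rewrite normrM -[leRHS]mul1r ler_pM//.
  by rewrite ger0_norm ?exprn_ge0// exprn_ile1.
by apply: primitive_bounded => //; lra.
Qed.

(* The lower bound (2x-1)^+ is automatic: the inner integral is empty when
   y < 2x - 1. *)
Lemma Omega_integral_from0 F x : K F x =
  \int[mu]_(y in `[0, x]) (y ^+ m * prim F (2^-1 + y / 2 - x)).
Proof.
have -> : `[Num.max 0 (2 * x - 1), x]%classic = `[0, x] `&` `[2 * x - 1, +oo[.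
  apply/seteqP; split => y /=; rewrite !in_itv/= ?ge_max ?andbT.
    by move=> /andP[/andP[-> ->] ->].
  by move=> [/andP[-> ->] ->].
rewrite Rintegral_mkcondr; apply: eq_Rintegral => y _; rewrite patchE.
case: ifPn => // /negP; rewrite inE/= in_itv/= andbT => /negP; rewrite -ltNge => yx.
by rewrite primitive_lt0 ?mulr0//; lra.
Qed.

(** Once the lower limit is replaced by 0, x occurs only in the upper limit and in the shift inside
    the primitive. Each contributes [M] to the Lipschitz constant [M + M]. *)
Lemma Omega_integral_continuous F M : 0 <= M -> measurable_fun (`[0, 1] : set R) F ->
  (forall z, 0 <= z <= 1 -> `|F z| <= M) -> {within `[0, 1], continuous (K F)}.
Proof.
move=> M0 mF FM; apply: (@lipschitz_within_continuous _ _ _ (M + M)) => s t /=.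
rewrite !in_itv/= => /andP[s0 s1] /andP[t0 t1] st.
rewrite !Omega_integral_from0.
set h := fun x y => y ^+ m * prim F (2^-1 + y / 2 - x).
have mh x : 0 <= x -> measurable_fun (`[0, s] : set R) (h x).
  move=> x0; apply: measurable_funS (measurable_integrand _ _ _ M0 mF FM x0) => //.
  by apply: subset_itvScc; rewrite bnd_simp.
have hM x : 0 <= x -> forall y, 0 <= y <= s -> `|h x y| <= M.
  move=> x0 y /andP[y0 ys]; apply: integrand_bounded => //.
  by rewrite y0 (le_trans ys).
have ih x (x0 : 0 <= x) := integrable_itvcc_bounded 0 s _ M (mh x x0) (hM x x0).
(* The intermediate term has the shift of [t] but the upper limit [s], which separates the two
   variations. *)
rewrite -(subrKA (\int[mu]_(y in `[0, s]) h t y)) (le_trans (ler_normD _ _))//.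
rewrite mulrDl lerD//.
  apply: (Rintegral_itvcc_lipschitz 0 1) => //.
    exact: (measurable_integrand _ M).
  exact: integrand_bounded.
rewrite -RintegralB//; [|exact: ih..].
(* The shift moves the primitive by at most M (t - s), while y^m <= 1 and the interval has length s
   <= 1. *)
rewrite (le_trans (normr_Rintegral_itvcc_le 0 s _ (M * (t - s)) s0 _ _))//.
- by apply: measurable_funB; exact: mh.
- move=> y /andP[y0 ys]; rewrite /h -mulrBr normrM distrC -[leRHS]mul1r ler_pM//.
    by rewrite ger0_norm ?exprn_ge0// exprn_ile1// (le_trans ys).
  apply: le_trans (Rintegral_itvcc_lipschitz 0 1 F M _ _ _ _ _ _ _) _ => //; lra.
- by rewrite subr0 ler_piMr// mulr_ge0// subr_ge0.
Qed.

(** Linearity of the outer and then of the inner integral; [M1] and [M2] serve to give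
    integrability. *)
Lemma Omega_integralB F1 F2 M1 M2 x : 0 <= M1 -> 0 <= M2 ->
  measurable_fun (`[0, 1] : set R) F1 -> measurable_fun (`[0, 1] : set R) F2 ->
  (forall z, 0 <= z <= 1 -> `|F1 z| <= M1) ->
  (forall z, 0 <= z <= 1 -> `|F2 z| <= M2) -> 0 <= x <= 1 ->
  K F1 x - K F2 x = K (F1 \- F2) x.
Proof.
move=> M10 M20 mF1 mF2 FM1 FM2 /andP[x0 x1].
have ih F M : 0 <= M -> measurable_fun (`[0, 1] : set R) F ->
    (forall z, 0 <= z <= 1 -> `|F z| <= M) ->
    mu.-integrable `[0, x]
      (EFin \o (fun y => y ^+ m * prim F (2^-1 + y / 2 - x))).
  move=> M0 mF FM; apply: (@integrable_itvcc_bounded _ _ _ _ M).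
    apply: measurable_funS (measurable_integrand _ _ _ M0 mF FM x0) => //.
    by apply: subset_itvScc; rewrite bnd_simp.
  move=> y /andP[y0 yx]; apply: integrand_bounded => //.
  by rewrite y0 (le_trans yx).
rewrite !Omega_integral_from0 -RintegralB//; [|exact: (ih _ M1)|exact: (ih _ M2)].
apply: eq_Rintegral => y; rewrite inE/= in_itv/= => /andP[y0 yx].
have iF F M : measurable_fun (`[0, 1] : set R) F ->
    (forall z, 0 <= z <= 1 -> `|F z| <= M) ->
    mu.-integrable `[0, 2^-1 + y / 2 - x] (EFin \o F).
  move=> mF FM; apply: integrableS (integrable_itvcc_bounded _ _ _ M mF FM) => //.
  by apply: subset_itvScc; rewrite bnd_simp//; lra.
by rewrite -mulrBr -RintegralB//; [exact: (iF _ M1)|exact: (iF _ M2)].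
Qed.

Lemma Omega_integral_le F M x : 0 <= M -> measurable_fun (`[0, 1] : set R) F ->
  (forall z, 0 <= z <= 1 -> `|F z| <= M) -> 0 <= x <= 1 ->
  `|K F x| <= M * ((1 - x) / 2) * (x ^+ m.+1 / m.+1%:R).
Proof.
move=> M0 mF FM /andP[x0 x1]; rewrite Omega_integral_from0 -Rintegral_exprn//.
have iexp : mu.-integrable `[0, x] (EFin \o (fun y => y ^+ m)).
  apply: continuous_compact_integrable; first exact: segment_compact.
  by apply: continuous_subspaceT => y; exact: exprn_continuous.
rewrite -RintegralZl//; apply: normr_Rintegral_le => //.
- apply: measurable_funS (measurable_integrand _ _ _ M0 mF FM x0) => //.
  by apply: subset_itvScc; rewrite bnd_simp.
- exact: (integrableZl _ (M * ((1 - x) / 2)) iexp).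
move=> y /=; rewrite in_itv/= => /andP[y0 yx].
rewrite normrM mulrC (ger0_norm (exprn_ge0 _ y0)) ler_wpM2r ?exprn_ge0//.
(* A negative upper limit gives 0; otherwise y <= x bounds it by (1 - x) / 2. *)
have [t0|t0] := ltP (2^-1 + y / 2 - x) 0.
  by rewrite primitive_lt0// normr0 mulr_ge0//; lra.
rewrite (le_trans (primitive_le _ _ _ mF FM _)) ?t0//; first lra.
by rewrite ler_wpM2l//; lra.
Qed.

End Omega_integrals.

(** * The sup norm and the contraction estimate *)

Lemma Linfty01_bound (R : realType) (F : R -> R) : Linfty01 F ->
  exists2 M, 0 <= M & forall z, 0 <= z <= 1 -> `|F z| <= M.
Proof.
move=> [_ /ex_strict_bound_gt0 [M M0 FM]]; exists M; first exact: ltW.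
by move=> z z01; apply/ltW/FM; rewrite /= in_itv.
Qed.

(** [sup] is an upper bound only when the set is bounded above; [M] witnesses this, and its size is
    irrelevant. *)
Lemma ler_supnorm01 (R : realType) (F : R -> R) (M z : R) :
  (forall y, 0 <= y <= 1 -> `|F y| <= M) -> 0 <= z <= 1 -> `|F z| <= supnorm01 F.
Proof.
move=> FM z01; apply: ub_le_sup; last by exists z; rewrite /= ?in_itv.
by exists M => _ [y /= + <-]; rewrite in_itv/=; exact: FM.
Qed.

Lemma supnorm01_le (R : realType) (F : R -> R) (M : R) :
  (forall z, 0 <= z <= 1 -> `|F z| <= M) -> supnorm01 F <= M.
Proof.
move=> FM; apply: ge_sup; first by exists `|F 0|, 0; rewrite //= in_itv/= lexx ler01.
by move=> _ [z /= + <-]; rewrite in_itv/=; exact: FM.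
Qed.

Lemma Linfty01_continuous (R : realType) (f : R -> R) :
  {within `[0, 1], continuous f} -> Linfty01 f.
Proof.
move=> cf; split; first exact: subspace_continuous_measurable_fun.
have /compact_bounded[M [Mreal fM]] := continuous_compact cf (@segment_compact _ 0 1).
by exists M; split=> // N MN x x01; apply: (fM N MN); exists x.
Qed.

(** With n = m + 2, [c] = (n - 1) / n is the maximizer of x^(n-1) (1 - x). Multiplying by [c] and
    using n c = n - 1 turns the claim into [exprn_interpolation] with exponent n - 1. *)
Lemma exprn_onem_le (R : realFieldType) (m : nat) (x : R) : 0 <= x ->
  m.+2%:R * x ^+ m.+1 * (1 - x) <= (m.+1%:R / m.+2%:R) ^+ m.+1.
Proof.
move=> x0; set c := m.+1%:R / m.+2%:R; have c0 : 0 < c by rewrite divr_gt0.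
have cE : m.+1%:R = m.+2%:R * c by rewrite mulrCA divff ?mulr1.
rewrite -(ler_pM2r c0) -exprSr; have := exprn_interpolation _ m.+1 _ _ x0 (ltW c0).
by rewrite cE (exprS x m.+1); lra.
Qed.

Lemma Omega_Linfty01 (R : realType) (n : nat) (F : R -> R) : (2 <= n)%N ->
  Linfty01 F -> Linfty01 (Omega n F).
Proof.
move=> n2 LF; have [M M0 FM] := Linfty01_bound _ _ LF.
have cK := Omega_integral_continuous (n - 2)%N F M M0 LF.1 FM.
apply: Linfty01_continuous; apply: within_continuousB.
  apply: continuous_subspaceT => x.
  by apply: cvgB; apply: cvgMl_tmp; exact: exprn_continuous.
by move=> x; apply: cvgMl_tmp; exact: cK.
Qed.

Lemma Omega_contraction (R : realType) (n : nat) (F1 F2 : R -> R) : (2 <= n)%N ->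
  Linfty01 F1 -> Linfty01 F2 ->
  supnorm01 (Omega n F1 \- Omega n F2) <=
    ((n - 1)%N%:R / n%:R) ^+ (n - 1)%N * supnorm01 (F1 \- F2).
Proof.
case: n => [|[|m]]// _ LF1 LF2.
have [M1 M10 FM1] := Linfty01_bound _ _ LF1.
have [M2 M20 FM2] := Linfty01_bound _ _ LF2.
have FM z : 0 <= z <= 1 -> `|(F1 \- F2) z| <= supnorm01 (F1 \- F2).
  apply: (@ler_supnorm01 _ _ (M1 + M2)) => y y01 /=.
  by rewrite (le_trans (ler_normB _ _))// lerD ?FM1 ?FM2.
have D0 : 0 <= supnorm01 (F1 \- F2).
  by apply: le_trans (FM 0 _) => //; rewrite lexx ler01.
apply: supnorm01_le => x /[dup] x01 /andP[x0 x1].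
(* The polynomial part p of [Omega] cancels, leaving a multiple of the difference of the double
   integrals. *)
have fold_diff (p c k1 k2 : R) : p - c * k1 - (p - c * k2) = - (c * (k1 - k2)).
  by ring.
rewrite /Omega /= fold_diff !subn1 !subn2 /=.
have mF : measurable_fun (`[0, 1] : set R) (F1 \- F2).
  by apply: measurable_funB; [case: LF1|case: LF2].
rewrite (Omega_integralB m F1 F2 M1 M2)//; [|exact: LF1.1|exact: LF2.1].
rewrite normrN normrM ger0_norm ?mulr_ge0//.
apply: le_trans (ler_wpM2r D0 (exprn_onem_le _ m _ x0)).
apply: le_trans (ler_wpM2l _ (Omega_integral_le m _ _ _ D0 mF FM x01)) _.
  by rewrite !mulr_ge0.
(* Both sides are equal: the factors 2 and n - 1 cancel against the denominators of the integral
   bound. *)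
by rewrite le_eqVlt; apply/predU1P; left; field; rewrite nat1r pnatr_eq0.
Qed.

Theorem theorem2 (R : realType) (n : nat) (hn : (2 <= n)%N) :
  let q : R := ((n - 1)%N%:R / n%:R) ^+ (n - 1)%N in
  [/\ forall F : R -> R, Linfty01 F -> Linfty01 (Omega n F),
      q < 1 &
      forall F1 F2 : R -> R, Linfty01 F1 -> Linfty01 F2 ->
        supnorm01 (Omega n F1 \- Omega n F2) <= q * supnorm01 (F1 \- F2)].
Proof.
move=> q; split=> [F LF||F1 F2 LF1 LF2].
- exact: Omega_Linfty01.
(* The exponent n - 1 is nonzero, so a base below 1 gives a power strictly below 1. *)
- case: n hn @q => [|[|n]]// _; rewrite !subn1/=.
  by rewrite exprn_ilt1// ltr_pdivrMr// mul1r ltr_nat.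
- exact: Omega_contraction.
Qed.
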